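(* Let $p>0$ and let $f\in\mathcal{B}$ with $f(z)=\sum_{k=0}^{\infty}a_kz^k$. Then $$|a_0|^p+\sum_{k=1}^{\infty}|a_k|r^k\le 1\qquad\text{for all } 0\le r\le r_p(|a_0|).$$ Moreover, for each $p>0$ the number $r_p(|a_0|)$ cannot be improved if $|a_0|\in[C(p),1)\cup\{0\}$; that is, for every $a\in[C(p),1)\cup\{0\}$ and every $r\in(r_p(a),1)$ there is $f\in\mathcal{B}$, $f(z)=\sum_{k\ge0}a_kz^k$, with $|a_0|=a$ and $|a_0|^p+\sum_{k\ge1}|a_k|r^k>1$.
   Context: $\mathbb{D}=\{z\in\mathbb{C}:|z|<1\}$, and $\mathcal{B}$ is the set of all analytic functions $f$ in $\mathbb{D}$ with $|f(z)|\le1$ for all $z\in\mathbb{D}$. For $p>0$, $C(p)$ denotes the unique solution of $1-x-x^p=0$ in $(0,1)$, and $r_p:[0,1]\to\mathbb{R}$ is defined by $$r_p(x)=\begin{cases}\dfrac{1-x^p}{\sqrt{1-x^2+(1-x^p)^2}}, & x\in[0,C(p)),\\[2mm] \dfrac{1-x^p}{1-x^2+x(1-x^p)}, & x\in[C(p),1),\\[2mm] \dfrac{p}{2+p}, & x=1.\end{cases}$$ One has $r_p(x)<1$ for all $x\in[0,1]$. *)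

(* Defs.v *)
From Stdlib Require Import Reals Ranalysis5 Lra.
From Coquelicot Require Import Coquelicot.
Open Scope R_scope.

(* [Rpower 0 p] evaluates to [exp 0 = 1]; real powers of a nonnegative base
   with exponent [p > 0] need the value [0 ^ p = 0]. *)
Definition rpow (x p : R) : R := if Req_EM_T x 0 then 0 else Rpower x p.

Definition is_Cp (p x : R) : Prop := 0 < x < 1 /\ 1 - x - rpow x p = 0.

(* [iota] is definite description; [Cp_unique] below shows that it applies for
   every [p > 0]. *)
Definition Cp (p : R) : R := iota (is_Cp p).

Lemma rpow_pos (x p : R) : 0 < x -> rpow x p = Rpower x p.
Proof. intros H; unfold rpow; destruct (Req_EM_T x 0); [lra | reflexivity]. Qed.

Lemma Cp_unique (p : R) : 0 < p -> exists! x : R, is_Cp p x.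
Proof.
intros Hp.
set (m := Rmax 1 (/ p)).
assert (Hm1 : 1 <= m) by apply Rmax_l.
assert (Hm2 : 1 <= p * m).
{ replace 1 with (p * / p) by (field; lra).
  apply Rmult_le_compat_l; [lra | apply Rmax_r]. }
assert (Hl : ln (/ 4) < 0) by (rewrite <- ln_1; apply ln_increasing; lra).
assert (Hle : forall t, 1 <= t -> exp (t * ln (/ 4)) <= / 4).
{ intros t Ht. rewrite <- (exp_ln (/ 4)) at 2 by lra.
  destruct (Req_dec t 1) as [-> | Hn]; [rewrite Rmult_1_l; lra |].
  left; apply exp_increasing; nra. }
set (b := Rpower (/ 4) m).
assert (Hb0 : 0 < b) by apply exp_pos.
assert (Hb1 : b <= / 4) by (apply Hle; lra).
assert (Hbp : Rpower b p <= / 4).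
{ unfold b; rewrite Rpower_mult; apply Hle; lra. }
assert (Hmon : forall x y, 0 < x < y -> Rpower x p < Rpower y p).
{ intros x y H; apply Rlt_Rpower_l; lra. }
destruct (IVT_interv (fun x => x + Rpower x p - 1) b 1) as [z [Hz1 Hz2]].
- intros x Hx. apply derivable_continuous_pt.
  apply ex_derive_Reals_0. unfold Rpower. auto_derive. lra.
- lra.
- lra.
- unfold Rpower; rewrite ln_1, Rmult_0_r, exp_0; lra.
- assert (Hz : 0 < z < 1).
  { split; [lra |]. assert (H := exp_pos (p * ln z)).
    unfold Rpower in Hz2; lra. }
  exists z; split.
  + split; [exact Hz |]. rewrite rpow_pos by lra. lra.
  + intros y [Hy Hy2]. rewrite rpow_pos in Hy2 by lra.
    destruct (Rtotal_order z y) as [H | [H | H]]; [| exact H |].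
    * assert (H' := Hmon z y (conj (proj1 Hz) H)); lra.
    * assert (H' := Hmon y z (conj (proj1 Hy) H)); lra.
Qed.

Lemma Cp_correct (p : R) : 0 < p -> is_Cp p (Cp p).
Proof. intros Hp. exact (iota_correct _ (Cp_unique p Hp)). Qed.

(* Only the values at [0 <= x <= 1] are meaningful. *)
Definition bohr_radius (p x : R) : R :=
  if Rlt_dec x (Cp p) then
    (1 - rpow x p) / sqrt (1 - x ^ 2 + (1 - rpow x p) ^ 2)
  else if Rlt_dec x 1 then
    (1 - rpow x p) / (1 - x ^ 2 + x * (1 - rpow x p))
  else p / (2 + p).

(* The class B: functions analytic (complex differentiable) in the open unit
   disc and bounded there by 1; values outside the disc are irrelevant. *)
Definition classB (f : C -> C) : Prop :=
  forall z : C, Cmod z < 1 ->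
    @ex_derive C_AbsRing C_NormedModule f z /\ Cmod (f z) <= 1.

Definition power_expansion (f : C -> C) (a : nat -> C) : Prop :=
  forall z : C, Cmod z < 1 -> @is_pseries C_AbsRing C_NormedModule a z (f z).

(* [s] is the sum of the series of [|a_k| r^k] over [k >= 1]. *)
Definition is_majorant_tail (a : nat -> C) (r s : R) : Prop :=
  is_series (fun k : nat => Cmod (a (S k)) * r ^ S k) s.

(* Main.v *)
(* Write [A = |a_0|^2]. Multiplication by [f] contracts square means over
   circles; applied to the test polynomial [1 + c z^N] this gives
   [sum_{k<N} |a_k|^2 + |a_N + c a_0|^2 <= 1 + |c|^2], and the best [c] yields
   [S_N <= (1 - A)^2 + A S_{N-1}] for [S_N = sum_{1<=k<=N} |a_k|^2]. Abel
   summation turns this into Goluzin's inequality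
   [sum_{k>=1} |a_k|^2 rho^k <= rho (1 - A)^2 / (1 - A rho)] on [0 <= rho <= 1].
   Splitting [r^2 = rho sigma], Cauchy-Schwarz bounds [sum_{k>=1} |a_k| r^k]:
   [rho = 1] is the right choice for [|a_0| < C(p)], and [rho = r / |a_0|]
   otherwise. The extremal functions are the Blaschke factor
   [(x - z) / (1 - x z)] for [x >= C(p)] and [z (b - z) / (1 - b z)] with
   [b = 1 / sqrt 2] for [x = 0].

   Square means are taken over roots of unity, so that no integration is
   needed. *)

Require Import Defs.
From Stdlib Require Import Reals Lra Lia.
From Coquelicot Require Import Coquelicot.
Open Scope R_scope.

(** * Means over roots of unity *)

(** The points [rho * w ^ j] with [w] a primitive root of unity of order [m + 1]. The factor 2
    stands apart because the telescoping sums below work with the half-angle [PI / INR (S m)]. *)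
Definition node (rho : R) (m j : nat) : C :=
  (rho * cos (2 * INR j * (PI / INR (S m))),
   rho * sin (2 * INR j * (PI / INR (S m)))).

Definition avg (rho : R) (m : nat) (g : C -> R) : R :=
  sum_f_R0 (fun j => g (node rho m j)) m / INR (S m).

Lemma Cmod_node (rho : R) (m j : nat) : 0 <= rho -> Cmod (node rho m j) = rho.
Proof.
intros Hr. unfold Cmod, node; simpl fst; simpl snd.
set (t := 2 * INR j * _).
replace (_ + _) with (rho ^ 2).
- now apply sqrt_pow2.
- assert (H := sin2_cos2 t). unfold Rsqr in H. nra.
Qed.

Lemma avg_plus (rho : R) (m : nat) (g h : C -> R) :
  avg rho m (fun z => g z + h z) = avg rho m g + avg rho m h.
Proof. unfold avg. rewrite sum_plus. field. apply not_0_INR; lia. Qed.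

Lemma avg_scal (rho : R) (m : nat) (g : C -> R) (c : R) :
  avg rho m (fun z => c * g z) = c * avg rho m g.
Proof.
unfold avg. rewrite (sum_eq _ (fun j => g (node rho m j) * c)).
- rewrite <- scal_sum. field. apply not_0_INR; lia.
- intros; ring.
Qed.

Lemma avg_const (rho : R) (m : nat) (c : R) : avg rho m (fun _ => c) = c.
Proof. unfold avg. rewrite sum_cte. field. apply not_0_INR; lia. Qed.

Lemma avg_le (rho : R) (m : nat) (g h : C -> R) :
  0 <= rho -> (forall z, Cmod z = rho -> g z <= h z) ->
  avg rho m g <= avg rho m h.
Proof.
intros Hr H. unfold avg, Rdiv. apply Rmult_le_compat_r.
- apply Rlt_le, Rinv_0_lt_compat, lt_0_INR; lia.
- apply sum_Rle; intros; apply H, Cmod_node, Hr.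
Qed.

Lemma avg_ext (rho : R) (m : nat) (g h : C -> R) :
  0 <= rho -> (forall z, Cmod z = rho -> g z = h z) -> avg rho m g = avg rho m h.
Proof.
intros Hr H. apply Rle_antisym; apply avg_le; try exact Hr;
  intros z Hz; rewrite (H z Hz); lra.
Qed.

(** Telescopes, because [2 sin h cos (2jh) = sin ((2j+1)h) - sin ((2j-1)h)]; the sine sum works
    alike. *)
Lemma sum_cos_double (h : R) (m : nat) :
  2 * sin h * sum_f_R0 (fun j => cos (2 * INR j * h)) m
  = sin ((2 * INR m + 1) * h) + sin h.
Proof.
induction m as [| m IH].
- simpl. replace (2 * 0 * h) with 0 by ring. rewrite cos_0.
  replace ((2 * 0 + 1) * h) with h by ring. ring.
- rewrite tech5, Rmult_plus_distr_l, IH, S_INR.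
  replace ((2 * INR m + 1) * h) with (2 * (INR m + 1) * h - h) by ring.
  replace ((2 * (INR m + 1) + 1) * h) with (2 * (INR m + 1) * h + h) by ring.
  rewrite sin_minus, sin_plus. ring.
Qed.

Lemma sum_sin_double (h : R) (m : nat) :
  2 * sin h * sum_f_R0 (fun j => sin (2 * INR j * h)) m
  = cos h - cos ((2 * INR m + 1) * h).
Proof.
induction m as [| m IH].
- simpl. replace (2 * 0 * h) with 0 by ring. rewrite sin_0.
  replace ((2 * 0 + 1) * h) with h by ring. ring.
- rewrite tech5, Rmult_plus_distr_l, IH, S_INR.
  replace ((2 * INR m + 1) * h) with (2 * (INR m + 1) * h - h) by ring.
  replace ((2 * (INR m + 1) + 1) * h) with (2 * (INR m + 1) * h + h) by ring.
  rewrite cos_minus, cos_plus. ring.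
Qed.

Lemma node_pow (rho : R) (m j k : nat) :
  Cpow (node rho m j) k
  = (rho ^ k * cos (2 * INR j * (INR k * PI / INR (S m))),
     rho ^ k * sin (2 * INR j * (INR k * PI / INR (S m)))).
Proof.
assert (HM : INR (S m) <> 0) by (apply not_0_INR; lia).
induction k as [| k IH].
- simpl Cpow. simpl INR. unfold Rdiv.
  rewrite Rmult_0_l, Rmult_0_l, Rmult_0_r, cos_0, sin_0.
  unfold RtoC. f_equal; simpl; ring.
- rewrite Cpow_S, IH, (S_INR k). unfold node, Cmult; simpl fst; simpl snd.
  replace (2 * INR j * ((INR k + 1) * PI / INR (S m)))
    with (2 * INR j * (PI / INR (S m)) + 2 * INR j * (INR k * PI / INR (S m)))
    by (field; exact HM).
  rewrite cos_plus, sin_plus. f_equal; simpl; ring.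
Qed.

Lemma avg_monomial (rho : R) (m k : nat) (c : C) :
  0 <= rho -> (0 < k <= m)%nat -> avg rho m (fun z => Re (c * Cpow z k)%C) = 0.
Proof.
intros Hr Hk.
assert (HM : 0 < INR (S m)) by (apply lt_0_INR; lia).
set (h := INR k * PI / INR (S m)).
assert (HkM : 0 < INR k < INR (S m)) by (split; [apply lt_0_INR | apply lt_INR]; lia).
assert (Hs : 0 < sin h).
{ assert (HP := PI_RGT_0). apply sin_gt_0; unfold h.
  - apply Rdiv_lt_0_compat; nra.
  - apply Rmult_lt_reg_r with (INR (S m)); [exact HM |].
    unfold Rdiv. rewrite Rmult_assoc, Rinv_l by lra. nra. }
(* Modulo [2 * PI] the end angle is [- h], so both closed forms vanish; [sin h > 0] can then be
   cancelled. *)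
assert (Hh : (2 * INR m + 1) * h = - h + 2 * INR k * PI).
{ unfold h. rewrite S_INR in *. field. lra. }
assert (Hc : sum_f_R0 (fun j => cos (2 * INR j * h)) m = 0).
{ assert (H := sum_cos_double h m). rewrite Hh, sin_period, sin_neg in H.
  apply (Rmult_eq_reg_l (2 * sin h)); lra. }
assert (Hsn : sum_f_R0 (fun j => sin (2 * INR j * h)) m = 0).
{ assert (H := sum_sin_double h m). rewrite Hh, cos_period, cos_neg in H.
  apply (Rmult_eq_reg_l (2 * sin h)); lra. }
unfold avg.
rewrite (sum_eq _ (fun j => cos (2 * INR j * h) * (rho ^ k * Re c)
                   + sin (2 * INR j * h) * (- rho ^ k * Im c))).
- rewrite sum_plus, <- !scal_sum, Hc, Hsn. unfold Rdiv. ring.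
- intros j _. rewrite node_pow. fold h. rewrite re_mult. simpl. ring.
Qed.

(* Analogue, for averages over the [m + 1] nodes, of being a polynomial of
   degree at most [d]: the products [z ^ k * F] without aliasing have their
   value at the origin as average. *)
Definition has_mean (rho : R) (m d : nat) (F : C -> C) : Prop :=
  forall (k : nat) (c : C), (k + d <= m)%nat ->
    avg rho m (fun z => Re (c * Cpow z k * F z)%C) = Re (c * Cpow 0 k * F 0)%C.

Lemma has_mean_le (rho : R) (m d e : nat) (F : C -> C) :
  (d <= e)%nat -> has_mean rho m d F -> has_mean rho m e F.
Proof. intros Hd HF k c Hk. apply HF. lia. Qed.

Lemma has_mean_ext (rho : R) (m d : nat) (F G : C -> C) :
  0 <= rho -> (forall z, F z = G z) -> has_mean rho m d F -> has_mean rho m d G.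
Proof.
intros Hr H HF k c Hk. rewrite <- H, <- (HF k c Hk).
apply avg_ext; [exact Hr |]. intros z _. now rewrite H.
Qed.

Lemma has_mean_const (rho : R) (m : nat) (b : C) :
  0 <= rho -> has_mean rho m 0 (fun _ => b).
Proof.
intros Hr [| k] c Hk.
- simpl. apply avg_const.
- rewrite (avg_ext _ _ _ (fun z => Re (c * b * Cpow z (S k))%C)).
  + rewrite avg_monomial by (auto; lia).
    rewrite Cpow_S. replace (c * (0 * 0 ^ k) * b)%C with (RtoC 0) by ring.
    reflexivity.
  + exact Hr.
  + intros z _. f_equal. ring.
Qed.

Lemma has_mean_plus (rho : R) (m d : nat) (F G : C -> C) :
  0 <= rho -> has_mean rho m d F -> has_mean rho m d G ->
  has_mean rho m d (fun z => F z + G z)%C.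
Proof.
intros Hr HF HG k c Hk.
rewrite (avg_ext _ _ _
  (fun z => Re (c * Cpow z k * F z)%C + Re (c * Cpow z k * G z)%C)).
- rewrite avg_plus, HF, HG by exact Hk. rewrite <- re_plus. f_equal. ring.
- exact Hr.
- intros z _. rewrite <- re_plus. f_equal. ring.
Qed.

Lemma has_mean_scal (rho : R) (m d : nat) (F : C -> C) (b : C) :
  0 <= rho -> has_mean rho m d F -> has_mean rho m d (fun z => b * F z)%C.
Proof.
intros Hr HF k c Hk.
rewrite (avg_ext _ _ _ (fun z => Re (c * b * Cpow z k * F z)%C)).
- rewrite HF by exact Hk. f_equal. ring.
- exact Hr.
- intros z _. f_equal. ring.
Qed.

Lemma has_mean_mult_id (rho : R) (m d : nat) (F : C -> C) :
  0 <= rho -> has_mean rho m d F -> has_mean rho m (S d) (fun z => z * F z)%C.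
Proof.
intros Hr HF k c Hk.
rewrite (avg_ext _ _ _ (fun z => Re (c * Cpow z (S k) * F z)%C)).
- rewrite HF by lia. f_equal. rewrite Cpow_S. ring.
- exact Hr.
- intros z _. f_equal. rewrite Cpow_S. ring.
Qed.

Lemma Cmod2_plus (u v : C) :
  Cmod (u + v)%C ^ 2 = Cmod u ^ 2 + Cmod v ^ 2 + 2 * Re (Cconj u * v)%C.
Proof. rewrite !Cmod2_alt. destruct u, v; simpl. ring. Qed.

(** Orthogonality of a constant and [z * F z]: the cross term is the mean of a function with a
    factor [z], which is 0 by [has_mean] at [k = 1]. *)
Lemma avg_Cmod2_split (rho : R) (m d : nat) (b : C) (F : C -> C) :
  0 <= rho -> (S d <= m)%nat -> has_mean rho m d F ->
  avg rho m (fun z => Cmod (b + z * F z)%C ^ 2)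
  = Cmod b ^ 2 + rho ^ 2 * avg rho m (fun z => Cmod (F z) ^ 2).
Proof.
intros Hr Hd HF.
rewrite (avg_ext _ _ _ (fun z => Cmod b ^ 2 + rho ^ 2 * Cmod (F z) ^ 2
   + 2 * Re (Cconj b * Cpow z 1 * F z)%C)).
- rewrite !avg_plus, avg_const, !avg_scal, HF by lia.
  rewrite Cpow_1_r. replace (Cconj b * 0 * F 0)%C with (RtoC 0) by ring.
  simpl. ring.
- exact Hr.
- intros z Hz. rewrite Cmod2_plus, Cmod_mult, Hz, Cpow_1_r, Rpow_mult_distr.
  do 3 f_equal. apply Cmult_assoc.
Qed.

(** Average [|F z - F 0|^2 >= 0], in the form [|F z|^2 >= 2 Re (conj (F 0) * F z) - |F 0|^2]. *)
Lemma avg_Cmod2_ge (rho : R) (m d : nat) (F : C -> C) :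
  0 <= rho -> (d <= m)%nat -> has_mean rho m d F ->
  Cmod (F 0%C) ^ 2 <= avg rho m (fun z => Cmod (F z) ^ 2).
Proof.
intros Hr Hd HF.
apply Rle_trans with (avg rho m (fun z => - Cmod (F 0%C) ^ 2
   + 2 * Re (Cconj (F 0%C) * Cpow z 0 * F z)%C)).
- rewrite avg_plus, avg_const, avg_scal, HF by lia. simpl Cpow.
  rewrite Cmod2_alt. destruct (F 0%C); simpl. lra.
- apply avg_le; [exact Hr |]. intros z _. simpl Cpow.
  rewrite !Cmod2_alt. destruct (F 0%C) as [u v], (F z) as [s t]; simpl.
  assert (H := Rle_0_sqr (u - s)). assert (H' := Rle_0_sqr (v - t)).
  unfold Rsqr in *. lra.
Qed.

(* [n] terms, i.e. degree at most [n - 1]. *)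
Fixpoint partial_sum (a : nat -> C) (n : nat) (z : C) : C :=
  match n with
  | O => 0
  | S n => a O + z * partial_sum (fun k => a (S k)) n z
  end%C.

Lemma partial_sum_add (n k : nat) : forall (a : nat -> C) (z : C),
  partial_sum a (n + k) z = (partial_sum a n z + Cpow z n * partial_sum (fun j => a (n + j)%nat) k z)%C.
Proof.
induction n as [| n IH]; intros a z.
- change (partial_sum a k z = 0 + 1 * partial_sum a k z)%C. ring.
- change (S n + k)%nat with (S (n + k)). simpl partial_sum. rewrite IH, Cpow_S. ring.
Qed.

Lemma partial_sum_S (a : nat -> C) (n : nat) (z : C) :
  partial_sum a (S n) z = (partial_sum a n z + Cpow z n * a n)%C.
Proof.
replace (S n) with (n + 1)%nat by lia. rewrite partial_sum_add. simpl.
rewrite Nat.add_0_r. ring.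
Qed.

Lemma has_mean_partial_sum (rho : R) (m n : nat) : 0 <= rho -> forall a : nat -> C,
  has_mean rho m n (partial_sum a (S n)).
Proof.
intros Hr. induction n as [| n IH]; intros a.
- intros k c Hk. simpl partial_sum.
  rewrite (avg_ext _ _ _ (fun z => Re (c * Cpow z k * a 0%nat)%C)).
  + rewrite (has_mean_const rho m (a 0%nat) Hr k c Hk). f_equal. ring.
  + exact Hr.
  + intros z _. f_equal. ring.
- change (partial_sum a (S (S n))) with
    (fun z => a 0%nat + z * partial_sum (fun k => a (S k)) (S n) z)%C.
  apply has_mean_plus; [exact Hr | |].
  + apply has_mean_le with 0%nat; [lia |]. now apply has_mean_const.
  + now apply has_mean_mult_id.
Qed.

(* [sum_{k<n} rho^(2k) |a_k|^2], in Horner form to match [avg_Cmod2_split]. *)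
Fixpoint energy (rho : R) (a : nat -> C) (n : nat) : R :=
  match n with
  | O => 0
  | S n => Cmod (a O) ^ 2 + rho ^ 2 * energy rho (fun k => a (S k)) n
  end.

Lemma has_mean_partial_sum_tail (rho : R) (m d n : nat) (G : C -> C) :
  0 <= rho -> has_mean rho m d G -> forall a : nat -> C,
  has_mean rho m (n + d) (fun z => partial_sum a n z + Cpow z n * G z)%C.
Proof.
intros Hr HG. induction n as [| n IH]; intros a.
- apply has_mean_ext with G; [exact Hr | | exact HG]. intros z. simpl. ring.
- apply has_mean_ext with (fun z => a 0%nat +
    z * (partial_sum (fun k => a (S k)) n z + Cpow z n * G z))%C.
  + exact Hr.
  + intros z. rewrite Cpow_S. simpl. ring.
  + apply has_mean_plus; [exact Hr | |].
    * apply has_mean_le with 0%nat; [lia |]. now apply has_mean_const.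
    * now apply has_mean_mult_id.
Qed.

(** A Bessel inequality: constant terms are split off orthogonally one at a time, and of the
    remainder [G] only its value at the origin is kept. *)
Lemma avg_Cmod2_ge_energy (rho : R) (m d n : nat) (G : C -> C) :
  0 <= rho -> (n + d <= m)%nat -> has_mean rho m d G -> forall a : nat -> C,
  energy rho a n + rho ^ (2 * n) * Cmod (G 0%C) ^ 2
  <= avg rho m (fun z => Cmod (partial_sum a n z + Cpow z n * G z)%C ^ 2).
Proof.
intros Hr Hm HG. induction n as [| n IH]; intros a.
- rewrite (avg_ext _ _ _ (fun z => Cmod (G z) ^ 2)); [| exact Hr |].
  + simpl energy. simpl (2 * 0)%nat. rewrite pow_O.
    assert (H := avg_Cmod2_ge rho m d G Hr Hm HG). lra.
  + intros z _. do 2 f_equal. simpl. ring.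
- rewrite (avg_ext _ _ _ (fun z => Cmod (a 0%nat +
    z * (partial_sum (fun k => a (S k)) n z + Cpow z n * G z))%C ^ 2)); [| exact Hr |].
  + rewrite (avg_Cmod2_split rho m (n + d)).
    * assert (H := IH ltac:(lia) (fun k => a (S k))).
      apply (Rmult_le_compat_l (rho ^ 2)) in H; [| apply pow2_ge_0].
      replace (2 * S n)%nat with (2 + 2 * n)%nat by lia.
      rewrite pow_add. simpl energy. lra.
    * exact Hr.
    * lia.
    * now apply has_mean_partial_sum_tail.
  + intros z _. do 2 f_equal. rewrite Cpow_S. simpl. ring.
Qed.
(** * Coefficient inequalities for bounded analytic functions *)

Lemma sum_n_partial_sum (a : nat -> C) (z : C) (n : nat) :
  sum_n (fun k => @scal C_AbsRing C_NormedModule (pow_n z k) (a k)) n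
  = partial_sum a (S n) z.
Proof.
assert (Hp : forall k, @pow_n C_Ring z k = Cpow z k).
{ induction k as [| k IH]; [reflexivity |].
  rewrite Cpow_S, <- IH. reflexivity. }
rewrite (sum_n_ext _ (fun k => (Cpow z k * a k)%C : C_NormedModule)).
- induction n as [| n IH].
  + rewrite sum_O, partial_sum_S. change ((1 * a 0%nat)%C = (0 + 1 * a 0%nat)%C). ring.
  + rewrite sum_Sn, IH, (partial_sum_S a (S n)). reflexivity.
- intros k. change ((@pow_n C_Ring z k * a k)%C = (Cpow z k * a k)%C).
  now rewrite Hp.
Qed.

Lemma power_expansion_cvg (f : C -> C) (a : nat -> C) (z : C) (eps : R) :
  power_expansion f a -> Cmod z < 1 -> 0 < eps ->
  exists n0, forall n, (n0 <= n)%nat -> Cmod (partial_sum a n z - f z)%C < eps.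
Proof.
intros Ha Hz He. specialize (Ha z Hz). unfold is_pseries, is_series in Ha.
assert (Hs : 0 < sqrt 2) by (apply sqrt_lt_R0; lra).
(* Balls of the uniform structure on [C] are squares, so passing to the modulus costs a factor
   [sqrt 2]. *)
assert (He' : 0 < eps / sqrt 2) by (apply Rdiv_lt_0_compat; lra).
destruct (proj1 (filterlim_locally _ _) Ha (mkposreal _ He')) as [n0 Hn].
exists (S n0). intros [| n] Hnn; [lia |].
specialize (Hn n ltac:(lia)). rewrite sum_n_partial_sum in Hn.
apply C_NormedModule_mixin_compat2 in Hn. simpl in Hn.
replace (sqrt 2 * (eps / sqrt 2)) with eps in Hn by (field; lra).
exact Hn.
Qed.

(** The term [a n * r ^ n] is the difference of two consecutive partial sums at [z = r], each
    eventually within 1/2 of [f r]. *)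
Lemma power_expansion_coeff_bound (f : C -> C) (a : nat -> C) (r : R) :
  power_expansion f a -> 0 <= r < 1 ->
  exists n0, forall n, (n0 <= n)%nat -> Cmod (a n) * r ^ n <= 1.
Proof.
intros Ha Hr.
assert (Hz : Cmod r < 1) by (rewrite Cmod_R, Rabs_pos_eq; lra).
destruct (power_expansion_cvg f a r (/ 2) Ha Hz ltac:(lra)) as [n0 Hn].
exists n0. intros n Hnn.
assert (H1 := Hn n Hnn). assert (H2 := Hn (S n) ltac:(lia)).
rewrite partial_sum_S in H2.
replace (Cmod (a n) * r ^ n) with
  (Cmod ((partial_sum a n r + Cpow r n * a n - f r) - (partial_sum a n r - f r))%C).
- eapply Rle_trans; [apply Cmod_triangle |]. rewrite Cmod_opp. lra.
- replace ((partial_sum a n r + Cpow r n * a n - f r) - (partial_sum a n r - f r))%C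
    with (Cpow r n * a n)%C by ring.
  rewrite Cmod_mult, Cmod_pow, Cmod_R, Rabs_pos_eq by lra. ring.
Qed.

Lemma partial_sum_tail_bound (b : nat -> C) (z : C) (A q : R) (k : nat) :
  0 <= q < 1 -> 0 <= A -> (forall j, Cmod (b j) * Cmod z ^ j <= A * q ^ j) ->
  Cmod (partial_sum b k z) <= A / (1 - q).
Proof.
intros Hq HA Hb.
assert (H : Cmod (partial_sum b k z) <= A * (1 - q ^ k) / (1 - q)).
{ induction k as [| k IH].
  - simpl. rewrite Cmod_0. unfold Rdiv. lra.
  - rewrite partial_sum_S. eapply Rle_trans; [apply Cmod_triangle |].
    rewrite Cmod_mult, Cmod_pow. assert (H := Hb k).
    replace (A * (1 - q ^ S k) / (1 - q))
      with (A * (1 - q ^ k) / (1 - q) + A * q ^ k).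
    + lra.
    + simpl. field. lra. }
eapply Rle_trans; [exact H |]. unfold Rdiv.
apply Rmult_le_compat_r; [apply Rlt_le, Rinv_0_lt_compat; lra |].
assert (H' := pow_le q k (proj1 Hq)). nra.
Qed.

(** For [r] strictly between [rho] and 1 the coefficients are eventually at most [r ^ (- n)], so on
    the circle the tails are dominated by a geometric series of ratio [rho / r], uniformly in
    [z]. *)
Lemma partial_sum_uniform_bound (f : C -> C) (a : nat -> C) (rho eps : R) (N : nat) :
  classB f -> power_expansion f a -> 0 < rho < 1 -> 0 < eps ->
  exists n, (N <= n)%nat /\ forall z, Cmod z = rho -> Cmod (partial_sum a n z) <= 1 + eps.
Proof.
intros Hf Ha Hrho He.
set (r := (1 + rho) / 2). set (q := rho / r).
assert (Hr : rho < r < 1) by (unfold r; lra).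
assert (Hq : 0 <= q < 1).
{ unfold q; split; [apply Rlt_le, Rdiv_lt_0_compat; lra |].
  apply Rmult_lt_reg_r with r; [lra |]. unfold Rdiv.
  rewrite Rmult_assoc, Rinv_l; lra. }
destruct (power_expansion_coeff_bound f a r Ha ltac:(lra)) as [n0 Hn0].
assert (Hq' : 0 < eps / 2 * (1 - q)) by (apply Rmult_lt_0_compat; lra).
destruct (pow_lt_1_zero q ltac:(rewrite Rabs_pos_eq; lra) _ Hq') as [n1 Hn1].
exists (N + n0 + n1)%nat. split; [lia |]. intros z Hz.
set (n := (N + n0 + n1)%nat).
(* Only [k] depends on [z], and the bound on the block [T] of [k] further terms does not involve
   [k]. *)
destruct (power_expansion_cvg f a z (eps / 2) Ha ltac:(lra) ltac:(lra)) as [k Hk].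
specialize (Hk (n + k)%nat ltac:(lia)).
assert (Hfz := proj2 (Hf z ltac:(lra))).
rewrite partial_sum_add in Hk.
set (T := (Cpow z n * partial_sum (fun j => a (n + j)%nat) k z)%C) in Hk.
assert (HT : Cmod T <= eps / 2).
{ assert (HT1 : Cmod (partial_sum (fun j => a (n + j)%nat) k z) * rho ^ n
     <= q ^ n / (1 - q)).
  { assert (Hrn : 0 < rho ^ n) by (apply pow_lt; lra).
    assert (H := partial_sum_tail_bound (fun j => a (n + j)%nat) z (q ^ n / rho ^ n) q k Hq).
    apply (Rmult_le_compat_r (rho ^ n)) in H.
    - eapply Rle_trans; [exact H |]. right. field. split; lra.
    - lra.
    - apply Rmult_le_pos; [apply pow_le; lra | apply Rlt_le, Rinv_0_lt_compat; lra].
    - intros j. rewrite Hz. apply Rmult_le_reg_r with (rho ^ n); [exact Hrn |].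
      replace (q ^ n / rho ^ n * q ^ j * rho ^ n) with (q ^ (n + j))
        by (rewrite pow_add; field; lra).
      replace (Cmod (a (n + j)%nat) * rho ^ j * rho ^ n)
        with (Cmod (a (n + j)%nat) * r ^ (n + j) * q ^ (n + j)).
      + rewrite <- (Rmult_1_l (q ^ (n + j))) at 2.
        apply Rmult_le_compat_r; [apply pow_le; lra |]. apply Hn0. lia.
      + rewrite Rmult_assoc, <- Rpow_mult_distr.
        replace (r * q) with rho by (unfold q; field; lra).
        rewrite pow_add. ring. }
  unfold T. rewrite Cmod_mult, Cmod_pow, Hz, Rmult_comm.
  eapply Rle_trans; [exact HT1 |].
  apply Rmult_le_reg_r with (1 - q); [lra |].
  unfold Rdiv at 1. rewrite Rmult_assoc, Rinv_l, Rmult_1_r by lra.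
  assert (H := Hn1 n ltac:(lia)).
  rewrite Rabs_pos_eq in H by (apply pow_le; lra). lra. }
replace (partial_sum a n z) with ((partial_sum a n z + T - f z) + (f z - T))%C by ring.
eapply Rle_trans; [apply Cmod_triangle |].
assert (H := Cmod_triangle (f z) (- T)). rewrite Cmod_opp in H.
unfold Cminus at 2. lra.
Qed.

(** Each weight [rho ^ (2k)] with [k < n] is at least [rho ^ (2n)]. *)
Lemma energy_ge (rho : R) (n : nat) : 0 <= rho <= 1 -> forall a : nat -> C,
  rho ^ (2 * n) * energy 1 a n <= energy rho a n.
Proof.
intros Hr. induction n as [| n IH]; intros a.
- simpl. lra.
- replace (2 * S n)%nat with (2 + 2 * n)%nat by lia. rewrite pow_add.
  simpl energy. assert (H := IH (fun k => a (S k))).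
  assert (H0 := pow2_ge_0 rho).
  assert (H1 := pow2_ge_0 (Cmod (a 0%nat))).
  assert (H2 : 0 <= rho ^ (2 * n) <= 1)
    by (split; [apply pow_le; lra | rewrite <- (pow1 (2 * n)); apply pow_incr; lra]).
  assert (H3 : rho ^ 2 <= 1) by nra.
  apply (Rmult_le_compat_l (rho ^ 2)) in H; [| exact H0].
  set (X := energy 1 _ n) in *. set (P := rho ^ (2 * n)) in *.
  assert (H4 : rho ^ 2 * P <= 1) by nra.
  assert (H5 : rho ^ 2 * P * Cmod (a 0%nat) ^ 2 <= 1 * Cmod (a 0%nat) ^ 2)
    by (apply Rmult_le_compat_r; assumption).
  lra.
Qed.

Lemma bernoulli_pow (d : R) (n : nat) : 0 <= d <= 1 -> 1 - INR n * d <= (1 - d) ^ n.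
Proof.
intros Hd. induction n as [| n IH].
- simpl. lra.
- rewrite S_INR. simpl. assert (H := pow_le (1 - d) n ltac:(lra)).
  assert (Hn := pos_INR n).
  apply (Rmult_le_compat_l (1 - d)) in IH; [| lra].
  assert (0 <= INR n * d * d) by (repeat apply Rmult_le_pos; lra). lra.
Qed.

(* The mean square over a circle of [f * q], for the test polynomial
   [q z = 1 + c * z ^ N], is at most that of [q]. *)
Lemma classB_contraction (f : C -> C) (a : nat -> C) (N : nat) (c : C) :
  classB f -> power_expansion f a -> (0 < N)%nat ->
  energy 1 a N + Cmod (a N + c * a 0%nat)%C ^ 2 <= 1 + Cmod c ^ 2.
Proof.
intros Hf Ha HN.
set (L := _ + _). set (Q := 1 + Cmod c ^ 2).
assert (HQ : 1 <= Q) by (unfold Q; assert (H := pow2_ge_0 (Cmod c)); lra).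
(* The claim on a smaller circle and up to [eps]; the limit [rho -> 1], [eps -> 0] is taken at the
   end. *)
assert (Hmain : forall rho eps, 0 < rho < 1 -> 0 < eps ->
  rho ^ (2 * N) * L <= (1 + eps) ^ 2 * Q).
{ intros rho eps Hrho He.
  destruct (partial_sum_uniform_bound f a rho eps (S N) Hf Ha Hrho He) as [n [HnN Hb]].
  destruct (Nat.le_exists_sub (S N) n HnN) as [e [Hn _]].
  replace n with (N + S e)%nat in Hb by lia. clear n HnN Hn.
  (* [2N + e] bounds the degree of the partial sum times [1 + c z^N], so no aliasing occurs. That
     product is [partial_sum a N z + z^N G z]. *)
  set (m := (N + (N + e))%nat).
  set (G := fun z => (partial_sum (fun j => a (N + j)%nat) (S e) z
                      + c * partial_sum a (S (N + e)) z)%C).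
  assert (HG : has_mean rho m (N + e) G).
  { apply has_mean_plus; [lra | |].
    - apply has_mean_le with e; [lia |]. apply has_mean_partial_sum. lra.
    - apply has_mean_scal; [lra |]. apply has_mean_partial_sum. lra. }
  assert (H1 := avg_Cmod2_ge_energy rho m (N + e) N G ltac:(lra) ltac:(lia) HG a).
  assert (HG0 : G 0%C = (a N + c * a 0%nat)%C).
  { unfold G. simpl partial_sum. rewrite Nat.add_0_r. ring. }
  rewrite HG0 in H1.
  assert (H2 := energy_ge rho N ltac:(lra) a).
  assert (H3 : avg rho m (fun z => Cmod (partial_sum a N z + Cpow z N * G z)%C ^ 2)
    <= avg rho m (fun z => (1 + eps) ^ 2 *
         (1 + Cmod c ^ 2 * rho ^ (2 * N) + 2 * Re (c * Cpow z N)%C))).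
  { apply avg_le; [lra |]. intros z Hz. specialize (Hb z Hz).
    replace (partial_sum a N z + Cpow z N * G z)%C
      with (partial_sum a (N + S e) z * (1 + c * Cpow z N))%C.
    - rewrite Cmod_mult, Rpow_mult_distr.
      replace (1 + _ + _) with (Cmod (1 + c * Cpow z N)%C ^ 2).
      + apply Rmult_le_compat_r; [apply pow2_ge_0 |].
        apply pow_incr. split; [apply Cmod_ge_0 | exact Hb].
      + rewrite Cmod2_plus, Cmod_mult, Cmod_pow, Hz, Rpow_mult_distr, Cmod_1.
        rewrite <- pow_mult, (Nat.mul_comm N 2), pow1.
        do 2 f_equal. simpl. ring.
    - unfold G. replace (S (N + e)) with (N + S e)%nat by lia.
      rewrite partial_sum_add. ring. }
  rewrite avg_scal, !avg_plus, (avg_scal _ _ _ 2), !avg_const, avg_monomial in H3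
    by (lra || (unfold m; lia)).
  assert (H4 : 0 <= rho ^ (2 * N) <= 1)
    by (split; [apply pow_le; lra | rewrite <- (pow1 (2 * N)); apply pow_incr; lra]).
  assert (H5 := pow2_ge_0 (Cmod c)).
  apply Rle_trans with ((1 + eps) ^ 2 * (1 + Cmod c ^ 2 * rho ^ (2 * N) + 2 * 0)).
  - unfold L. lra.
  - apply Rmult_le_compat_l; [apply pow2_ge_0 |]. unfold Q. nra. }
assert (HL : 0 <= L).
{ assert (Hen : forall n b, 0 <= energy 1 b n).
  { induction n as [| n IH]; intros b; simpl energy; [lra |].
    assert (H' := IH (fun k => b (S k))). assert (H'' := pow2_ge_0 (Cmod (b 0%nat))).
    lra. }
  unfold L. assert (H' := Hen N a).
  assert (H'' := pow2_ge_0 (Cmod (a N + c * a 0%nat)%C)). lra. }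
apply Rnot_lt_le. intros Hlt.
(* Taking [rho = 1 - d] and [eps = d], Bernoulli's inequality and [(1 + d)^2 <= 1 + 3d] turn [Hmain]
   into [L - Q <= d * K]; [d] is chosen to make [d * K] at most half of [L - Q]. *)
set (K := INR (2 * N) * L + 3 * Q).
assert (HK : 0 < K).
{ unfold K. assert (H := pos_INR (2 * N)). nra. }
set (d := Rmin (/ 2) ((L - Q) / (2 * K))).
assert (Hd0 : 0 < (L - Q) / (2 * K)) by (apply Rdiv_lt_0_compat; lra).
assert (Hd : 0 < d) by (unfold d; apply Rmin_pos; lra).
assert (Hd1 : d <= / 2) by apply Rmin_l.
assert (Hd2 : d * K <= (L - Q) / 2).
{ apply Rle_trans with ((L - Q) / (2 * K) * K).
  - apply Rmult_le_compat_r; [lra | apply Rmin_r].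
  - right. field. lra. }
assert (H := Hmain (1 - d) d ltac:(lra) Hd).
assert (H1 := bernoulli_pow d (2 * N) ltac:(lra)).
apply (Rmult_le_compat_r L) in H1; [| exact HL].
assert (H2 : (1 + d) ^ 2 * Q <= (1 + 3 * d) * Q)
  by (apply Rmult_le_compat_r; [lra | nra]).
unfold K in Hd2. lra.
Qed.

(** * Parseval's and Goluzin's inequalities *)

Lemma energy_1 (n : nat) : forall a : nat -> C,
  energy 1 a (S n) = sum_f_R0 (fun k => Cmod (a k) ^ 2) n.
Proof.
induction n as [| n IH]; intros a.
- simpl. ring.
- rewrite decomp_sum by lia. change (energy 1 a (S (S n)))
    with (Cmod (a 0%nat) ^ 2 + 1 ^ 2 * energy 1 (fun k => a (S k)) (S n)).
  rewrite IH. simpl Nat.pred. ring.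
Qed.

(** The case [c = 0] of [classB_contraction]. *)
Lemma classB_parseval (f : C -> C) (a : nat -> C) (n : nat) :
  classB f -> power_expansion f a ->
  Cmod (a 0%nat) ^ 2 + sum_f_R0 (fun k => Cmod (a (S k)) ^ 2) n <= 1.
Proof.
intros Hf Ha.
assert (H := classB_contraction f a (S n) 0 Hf Ha ltac:(lia)).
rewrite energy_1, Cmod_0, Cmult_0_l, Cplus_0_r in H.
assert (H1 := tech5 (fun k => Cmod (a k) ^ 2) n).
rewrite (decomp_sum _ (S n)) in H1 by lia. simpl Nat.pred in H1.
rewrite H1. lra.
Qed.

(* The choice [c = conj a_0 * a_N / (1 - |a_0|^2)] in [classB_contraction]. *)
Lemma classB_coeff_improved (f : C -> C) (a : nat -> C) (n : nat) :
  classB f -> power_expansion f a -> Cmod (a 0%nat) < 1 ->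
  (1 - Cmod (a 0%nat) ^ 2) * sum_f_R0 (fun k => Cmod (a k) ^ 2) n
  + Cmod (a (S n)) ^ 2 <= 1 - Cmod (a 0%nat) ^ 2.
Proof.
intros Hf Ha H0. set (A := Cmod (a 0%nat) ^ 2).
assert (HA : 0 <= A < 1).
{ unfold A. assert (H := Cmod_ge_0 (a 0%nat)). nra. }
assert (HAC : RtoC (1 - A) <> 0%C) by (intros H; apply RtoC_inj in H; lra).
set (c := (Cconj (a 0%nat) * a (S n) / RtoC (1 - A))%C).
assert (H := classB_contraction f a (S n) c Hf Ha ltac:(lia)).
rewrite energy_1 in H.
replace (a (S n) + c * a 0%nat)%C with (a (S n) / RtoC (1 - A))%C in H.
- unfold c in H. rewrite !Cmod_div, !Cmod_mult, Cmod_conj, Cmod_R, Rabs_pos_eq in H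
    by (exact HAC || lra).
  set (t := Cmod (a (S n))) in *. set (X := Cmod (a 0%nat)) in *.
  set (S0 := sum_f_R0 _ n) in *.
  (* Exposes [(t / (1 - A)) ^ 2], which is [|a_N + c a_0|^2] and cancels with the left-hand side. *)
  replace (1 + (X * t / (1 - A)) ^ 2)
    with ((t / (1 - A)) ^ 2 + (1 - t ^ 2 / (1 - A))) in H
    by (unfold A in *; field; lra).
  assert (H1 : S0 <= 1 - t ^ 2 / (1 - A)) by lra.
  apply (Rmult_le_compat_l (1 - A)) in H1; [| lra].
  replace ((1 - A) * (1 - t ^ 2 / (1 - A))) with (1 - A - t ^ 2) in H1
    by (field; lra).
  lra.
- unfold c. assert (Hc := Cmod2_conj (a 0%nat)). fold A in Hc.
  assert (E : RtoC (1 - A) = (1 - a 0%nat * Cconj (a 0%nat))%C)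
    by (rewrite RtoC_minus, Hc; reflexivity).
  rewrite E in *. field. exact HAC.
Qed.

(** The recursion passes to the weighted sums as [W (n+1) <= rho (1-A)^2 + A rho W n], whose fixed
    point is the bound. It is the full sum for the extremal sequence [x k = (1-A)^2 A^k]. *)
Lemma weighted_sum_le (x : nat -> R) (A rho : R) (n : nat) :
  0 <= A < 1 -> 0 <= rho <= 1 -> x 0%nat <= (1 - A) ^ 2 ->
  (forall n, sum_f_R0 x (S n) <= (1 - A) ^ 2 + A * sum_f_R0 x n) ->
  sum_f_R0 (fun k => x k * rho ^ S k) n <= rho * (1 - A) ^ 2 / (1 - A * rho).
Proof.
intros HA Hrho H0 HS.
set (W := sum_f_R0 (fun k => x k * rho ^ S k)).
assert (HArho : 0 <= A * rho < 1) by nra.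
(* Abel summation against the decreasing weights [rho ^ k]. *)
assert (HW : forall n, rho ^ (S (S n))
    * ((1 - A) ^ 2 + A * sum_f_R0 x n - sum_f_R0 x (S n))
  <= rho * (1 - A) ^ 2 + A * rho * W n - W (S n)).
{ induction n0 as [| k IH].
  - unfold W. simpl.
    assert (H : 0 <= rho * (1 - rho) * ((1 - A) ^ 2 - x 0%nat))
      by (repeat apply Rmult_le_pos; lra).
    simpl in H. lra.
  - assert (HE := HS k).
    assert (Hp := pow_le rho (S (S k)) (proj1 Hrho)).
    assert (HWS : W (S (S k)) = W (S k) + x (S (S k)) * rho ^ S (S (S k)))
      by apply tech5.
    assert (HWS' : W (S k) = W k + x (S k) * rho ^ S (S k)) by apply tech5.
    assert (HSS := tech5 x (S k)). assert (HSS' := tech5 x k).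
    change (rho ^ S (S (S k))) with (rho * rho ^ S (S k)) in *.
    set (P := rho ^ S (S k)) in *. set (E := (1 - A) ^ 2) in *.
    (* [D] is the slack of the recursion at [k]. At the next index its weight shrinks by [rho <= 1],
       while the new terms enter both sides with the same weight [rho * P]. *)
    set (D := E + A * sum_f_R0 x k - sum_f_R0 x (S k)) in *.
    replace (E + A * sum_f_R0 x (S k) - sum_f_R0 x (S (S k)))
      with (D + A * x (S k) - x (S (S k))) by (unfold D; rewrite HSS, HSS'; ring).
    rewrite HWS. assert (HD : 0 <= D) by (unfold D; lra).
    assert (H1 : rho * (P * D) <= 1 * (P * D))
      by (apply Rmult_le_compat_r; [apply Rmult_le_pos |]; lra).
    rewrite HWS' in *. lra. }
set (B := _ / _).
assert (HB : B = rho * (1 - A) ^ 2 + A * rho * B) by (unfold B; field; lra).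
assert (HB0 : rho * (1 - A) ^ 2 <= B).
{ assert (0 <= B).
  { unfold B. apply Rmult_le_pos.
    - apply Rmult_le_pos; [lra | apply pow2_ge_0].
    - apply Rlt_le, Rinv_0_lt_compat. lra. }
  assert (0 <= A * rho * B) by (apply Rmult_le_pos; lra). lra. }
induction n as [| n IH].
- unfold W. simpl. simpl in HB0, H0.
  apply (Rmult_le_compat_l rho) in H0; lra.
- assert (H := HW n).
  assert (H1 : 0 <= rho ^ S (S n)
    * ((1 - A) ^ 2 + A * sum_f_R0 x n - sum_f_R0 x (S n))).
  { apply Rmult_le_pos; [apply pow_le; lra |]. assert (HE := HS n). lra. }
  apply (Rmult_le_compat_l (A * rho)) in IH; lra.
Qed.

(** Goluzin's inequality for partial sums: once [|a_0|^2] is separated from the sum,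
    [classB_coeff_improved] is the recursion of [weighted_sum_le]. *)
Lemma classB_weighted_square_sum (f : C -> C) (a : nat -> C) (rho : R) (n : nat) :
  classB f -> power_expansion f a -> Cmod (a 0%nat) < 1 -> 0 <= rho <= 1 ->
  sum_f_R0 (fun k => Cmod (a (S k)) ^ 2 * rho ^ S k) n
  <= rho * (1 - Cmod (a 0%nat) ^ 2) ^ 2 / (1 - Cmod (a 0%nat) ^ 2 * rho).
Proof.
intros Hf Ha H0 Hrho.
assert (HX := Cmod_ge_0 (a 0%nat)).
apply (weighted_sum_le (fun k => Cmod (a (S k)) ^ 2)).
- nra.
- exact Hrho.
- assert (H := classB_coeff_improved f a 0 Hf Ha H0). simpl in *. lra.
- intros k. assert (H := classB_coeff_improved f a (S k) Hf Ha H0).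
  rewrite (decomp_sum _ (S k)) in H by lia. simpl Nat.pred in H.
  rewrite tech5. lra.
Qed.

(** * The Bohr inequality *)

Lemma sum_geom_le (q : R) (n : nat) :
  0 <= q < 1 -> sum_f_R0 (fun k => q ^ S k) n <= q / (1 - q).
Proof.
intros Hq.
rewrite (sum_eq _ (fun k => q ^ k * q)) by (intros; simpl; ring).
rewrite <- scal_sum, tech3 by lra. unfold Rdiv.
rewrite <- Rmult_assoc. apply Rmult_le_compat_r.
- apply Rlt_le, Rinv_0_lt_compat. lra.
- assert (H := pow_le q (S n) (proj1 Hq)). nra.
Qed.

(* Cauchy-Schwarz in its weighted AM-GM form; minimizing over [l] gives
   [sqrt (B * (sigma / (1 - sigma)))]. *)
Lemma sum_cauchy_schwarz (y : nat -> R) (r rho sigma l B : R) (n : nat) :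
  0 < l -> 0 <= rho -> 0 <= sigma < 1 -> rho * sigma = r ^ 2 ->
  sum_f_R0 (fun k => y k ^ 2 * rho ^ S k) n <= B ->
  sum_f_R0 (fun k => y k * r ^ S k) n <= (l * B + sigma / (1 - sigma) / l) / 2.
Proof.
intros Hl Hrho Hs Hr HB.
assert (Hs' := sum_geom_le sigma n Hs).
assert (Hl' : 0 < / l) by now apply Rinv_0_lt_compat.
apply Rle_trans with (sum_f_R0 (fun k => y k ^ 2 * rho ^ S k * (l / 2)
   + sigma ^ S k * (/ l / 2)) n).
- apply sum_Rle. intros k _.
  assert (Hk : (r ^ S k) ^ 2 = rho ^ S k * sigma ^ S k).
  { rewrite <- Rpow_mult_distr, Hr, <- !pow_mult. f_equal. lia. }
  assert (HP := pow_le rho (S k) Hrho).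
  assert (HQ := pow_le sigma (S k) (proj1 Hs)).
  set (P := rho ^ S k) in *. set (Q := sigma ^ S k) in *.
  set (w := r ^ S k) in *.
  (* AM-GM after squaring: with [u = y^2 P l] and [v = Q / l], one has
     [((u + v) / 2)^2 = u v + (u - v)^2 / 4]. *)
  apply Rsqr_incr_0_var; unfold Rsqr.
  + replace (y k * w * (y k * w)) with (y k ^ 2 * (P * Q)) by (rewrite <- Hk; ring).
    assert (H := pow2_ge_0 (y k ^ 2 * P * l - Q * / l)).
    replace ((y k ^ 2 * P * (l / 2) + Q * (/ l / 2))
             * (y k ^ 2 * P * (l / 2) + Q * (/ l / 2)))
      with (y k ^ 2 * (P * Q) + (y k ^ 2 * P * l - Q * / l) ^ 2 / 4)
      by (field; lra).
    lra.
  + assert (Hy := pow2_ge_0 (y k)).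
    assert (0 <= y k ^ 2 * P * (l / 2))
      by (apply Rmult_le_pos; [apply Rmult_le_pos |]; lra).
    assert (0 <= Q * (/ l / 2)) by (apply Rmult_le_pos; lra). lra.
- rewrite sum_plus, <- !scal_sum.
  apply (Rmult_le_compat_l (l / 2)) in HB; [| lra].
  apply (Rmult_le_compat_l (/ l / 2)) in Hs'; [| lra].
  unfold Rdiv in *. lra.
Qed.

Lemma majorant_tail_le (a : nat -> C) (r T : R) : 0 <= r ->
  (forall n, sum_f_R0 (fun k => Cmod (a (S k)) * r ^ S k) n <= T) ->
  exists s, is_majorant_tail a r s /\ s <= T.
Proof.
intros Hr HT.
set (u := fun k => Cmod (a (S k)) * r ^ S k) in *.
assert (Hu : forall n, sum_n u n <= T) by (intros n; rewrite sum_n_Reals; apply HT).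
destruct (ex_finite_lim_seq_incr (sum_n u) T) as [s Hs].
- intros n. rewrite sum_Sn. change (sum_n u n <= sum_n u n + u (S n)).
  assert (0 <= u (S n)) by (apply Rmult_le_pos; [apply Cmod_ge_0 | now apply pow_le]).
  lra.
- exact Hu.
- exists s. split; [exact Hs |].
  exact (is_lim_seq_le (sum_n u) (fun _ => T) s T Hu Hs (is_lim_seq_const T)).
Qed.

(** Parseval's inequality leaves no room for further coefficients. *)
Lemma classB_coeff_0_unimodular (f : C -> C) (a : nat -> C) (k : nat) :
  classB f -> power_expansion f a -> 1 <= Cmod (a 0%nat) ->
  Cmod (a (S k)) = 0.
Proof.
intros Hf Ha H0.
assert (H := classB_parseval f a k Hf Ha).
assert (Hk : Cmod (a (S k)) ^ 2
    <= sum_f_R0 (fun k => Cmod (a (S k)) ^ 2) k).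
{ destruct k as [| k]; [simpl; lra |]. rewrite tech5.
  assert (Hp := cond_pos_sum (fun k => Cmod (a (S k)) ^ 2) k
    (fun j => pow2_ge_0 _)). lra. }
assert (Hc := Cmod_ge_0 (a (S k))). nra.
Qed.

Lemma rpow_bounds (x p : R) : 0 < p -> 0 <= x < 1 -> 0 <= rpow x p < 1.
Proof.
intros Hp Hx. unfold rpow. destruct (Req_EM_T x 0) as [_ | Hx0]; [lra |].
split; [apply Rlt_le, exp_pos |].
assert (H := Rlt_Rpower_l x 1 p Hp ltac:(lra)).
unfold Rpower in H at 2. rewrite ln_1, Rmult_0_r, exp_0 in H. exact H.
Qed.

(** The left side decreases in [x] and equals [Cp p] at [Cp p]. This is what makes [rho = r / |a_0|]
    at most 1 in the second range. *)
Lemma rpow_ge_Cp (x p : R) : 0 < p -> Cp p <= x -> 1 - rpow x p <= x.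
Proof.
intros Hp Hx. destruct (Cp_correct p Hp) as [HC HC'].
assert (H : rpow (Cp p) p <= rpow x p).
{ rewrite !rpow_pos by lra. apply Rle_Rpower_l; lra. }
lra.
Qed.

Lemma bohr_radius_small (p x r : R) : 0 < p -> 0 <= x < Cp p ->
  0 <= r <= bohr_radius p x ->
  r ^ 2 * (1 - x ^ 2) <= (1 - rpow x p) ^ 2 * (1 - r ^ 2).
Proof.
intros Hp Hx. destruct (Cp_correct p Hp) as [HC _].
unfold bohr_radius. destruct (Rlt_dec x (Cp p)) as [_ | Hn]; [| lra].
assert (HT : 0 < 1 - rpow x p <= 1)
  by (assert (H := rpow_bounds x p Hp ltac:(lra)); lra).
set (T := 1 - rpow x p) in *. set (D := 1 - x ^ 2 + T ^ 2).
assert (HD : 0 < D).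
{ assert (0 < (1 - x) * (1 + x)) by (apply Rmult_lt_0_compat; lra).
  assert (H' := pow2_ge_0 T). unfold D. lra. }
assert (HsD := sqrt_lt_R0 D HD).
intros [Hr0 Hr].
assert (Hr2 : r * sqrt D <= T).
{ apply (Rmult_le_compat_r (sqrt D)) in Hr; [| lra].
  unfold Rdiv in Hr. rewrite Rmult_assoc, Rinv_l, Rmult_1_r in Hr; lra. }
assert (H : (r * sqrt D) ^ 2 <= T ^ 2).
{ apply pow_incr. split; [apply Rmult_le_pos; lra | exact Hr2]. }
rewrite Rpow_mult_distr, pow2_sqrt in H by lra. unfold D in H. lra.
Qed.

Lemma bohr_inequality (p : R) (f : C -> C) (a : nat -> C) (r : R) :
  0 < p -> classB f -> power_expansion f a ->
  0 <= r <= bohr_radius p (Cmod (a 0%nat)) ->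
  exists s, is_majorant_tail a r s /\ rpow (Cmod (a 0%nat)) p + s <= 1.
Proof.
intros Hp Hf Ha Hr.
set (X := Cmod (a 0%nat)) in *.
assert (HX0 : 0 <= X) by apply Cmod_ge_0.
destruct (Cp_correct p Hp) as [HC _].
destruct (Rlt_or_le X 1) as [HX1 | HX1].
- enough (Hsum : forall n, sum_f_R0 (fun k => Cmod (a (S k)) * r ^ S k) n
      <= 1 - rpow X p).
  { destruct (majorant_tail_le a r _ (proj1 Hr) Hsum) as [s [Hs HsT]].
    exists s. split; [exact Hs | lra]. }
  intros n.
  assert (HT : 0 < 1 - rpow X p <= 1)
    by (assert (H := rpow_bounds X p Hp ltac:(lra)); lra).
  assert (HA : X ^ 2 < 1) by nra.
  destruct (Rlt_or_le X (Cp p)) as [HXC | HXC].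
  + assert (H := bohr_radius_small p X r Hp ltac:(lra) Hr).
    set (T := 1 - rpow X p) in *.
    assert (Hr2 : 0 <= r ^ 2 < 1) by (split; [apply pow2_ge_0 | nra]).
    assert (HW := classB_weighted_square_sum f a 1 n Hf Ha HX1 ltac:(lra)).
    fold X in HW.
    (* This [l] is the optimal one when [r] equals the radius. As [B = 1 - X^2], it gives
       [l * B = T]; [bohr_radius_small] bounds the other half by [T]. *)
    apply (sum_cauchy_schwarz (fun k => Cmod (a (S k))) r 1 (r ^ 2) (T / (1 - X ^ 2)))
      in HW; [| apply Rdiv_lt_0_compat; lra | lra | exact Hr2 | ring].
    eapply Rle_trans; [exact HW |].
    assert (H1 : r ^ 2 / (1 - r ^ 2) / (T / (1 - X ^ 2)) <= T).
    { apply Rmult_le_reg_r with (T * (1 - r ^ 2)); [apply Rmult_lt_0_compat; lra |].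
      replace (_ / (T / _) * _) with (r ^ 2 * (1 - X ^ 2)) by (field; lra). lra. }
    replace (T / (1 - X ^ 2) * (1 * (1 - X ^ 2) ^ 2 / (1 - X ^ 2 * 1))) with T
      by (field; lra).
    lra.
  + assert (HTX := rpow_ge_Cp X p Hp HXC).
    unfold bohr_radius in Hr. destruct (Rlt_dec X (Cp p)); [lra |].
    destruct (Rlt_dec X 1); [| lra].
    set (T := 1 - rpow X p) in *.
    assert (HXT : 0 < X * T) by (apply Rmult_lt_0_compat; lra).
    assert (Hr1 : r * (1 - X ^ 2 + X * T) <= T).
    { destruct Hr as [_ Hr].
      apply (Rmult_le_compat_r (1 - X ^ 2 + X * T)) in Hr; [| lra].
      unfold Rdiv in Hr. rewrite Rmult_assoc, Rinv_l, Rmult_1_r in Hr; lra. }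
    (* Follows from [X (1 - X^2 + X T) - T = (1 - X^2) (X - T)] and [T <= X]. *)
    assert (HrX : r <= X).
    { apply Rmult_le_reg_r with (1 - X ^ 2 + X * T); [lra |].
      assert (0 <= (1 - X ^ 2) * (X - T)) by (apply Rmult_le_pos; lra). nra. }
    assert (Hs : 0 <= X * r < 1) by nra.
    assert (Hrho : 0 <= r / X <= 1).
    { split; [apply Rmult_le_pos; [lra | apply Rlt_le, Rinv_0_lt_compat; lra] |].
      apply Rmult_le_reg_r with X; [lra |].
      unfold Rdiv. rewrite Rmult_assoc, Rinv_l; lra. }
    assert (HW := classB_weighted_square_sum f a (r / X) n Hf Ha HX1 Hrho).
    fold X in HW.
    (* With this optimal [l] both halves equal [r (1 - X^2) / (1 - X r)], the tail attained by the
       Blaschke factor; [Hr1] says that it is at most [T]. *)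
    apply (sum_cauchy_schwarz (fun k => Cmod (a (S k))) r (r / X) (X * r)
      (X / (1 - X ^ 2))) in HW;
      [| apply Rdiv_lt_0_compat; lra | lra | exact Hs | field; lra].
    eapply Rle_trans; [exact HW |].
    replace (_ / 2) with (r * (1 - X ^ 2) / (1 - X * r)).
    * apply Rmult_le_reg_r with (1 - X * r); [lra |].
      unfold Rdiv. rewrite Rmult_assoc, Rinv_l by lra. lra.
    * field. repeat split; lra.
- assert (H0 := fun k => classB_coeff_0_unimodular f a k Hf Ha HX1).
  assert (Hsum : forall n, sum_f_R0 (fun k => Cmod (a (S k)) * r ^ S k) n <= 0).
  { intros n. rewrite (sum_eq _ (fun _ => 0)).
    - rewrite sum_cte. lra.
    - intros k _. rewrite H0. ring. }
  destruct (majorant_tail_le a r 0 (proj1 Hr) Hsum) as [s [Hs Hs0]].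
  exists s. split; [exact Hs |].
  assert (HP := classB_parseval f a 0 Hf Ha). simpl in HP. fold X in HP.
  assert (H1 := Cmod_ge_0 (a 1%nat)).
  assert (HX : X = 1) by nra.
  rewrite HX, rpow_pos by lra. unfold Rpower. rewrite ln_1, Rmult_0_r, exp_0. lra.
Qed.
(** * Extremal functions *)

Definition blaschke (x : R) (z : C) : C := ((x - z) / (1 - x * z))%C.

Definition blaschke_coeff (x : R) (n : nat) : C :=
  match n with O => x | S k => RtoC (- (1 - x ^ 2) * x ^ k) end.

Lemma blaschke_den_ge (x : R) (z : C) :
  0 <= x < 1 -> Cmod z < 1 -> 1 - x <= Cmod (1 - x * z)%C.
Proof.
intros Hx Hz.
assert (H := Cmod_triangle (1 - x * z) (x * z)).
replace (1 - x * z + x * z)%C with (RtoC 1) in H by ring.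
rewrite Cmod_1, Cmod_mult, Cmod_R, Rabs_pos_eq in H by lra.
assert (Hz0 := Cmod_ge_0 z). nra.
Qed.

Lemma blaschke_den_neq_0 (x : R) (z : C) :
  0 <= x < 1 -> Cmod z < 1 -> (1 - x * z)%C <> 0%C.
Proof.
intros Hx Hz H. assert (H' := blaschke_den_ge x z Hx Hz).
rewrite H, Cmod_0 in H'. lra.
Qed.

Lemma blaschke_le_1 (x : R) (z : C) :
  0 <= x < 1 -> Cmod z < 1 -> Cmod (blaschke x z) <= 1.
Proof.
intros Hx Hz. assert (Hd := blaschke_den_ge x z Hx Hz).
unfold blaschke. rewrite Cmod_div by now apply blaschke_den_neq_0.
apply Rmult_le_reg_r with (Cmod (1 - x * z)%C); [lra |].
unfold Rdiv. rewrite Rmult_assoc, Rinv_l, Rmult_1_r, Rmult_1_l by lra.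
apply Rsqr_incr_0_var; [| lra]. rewrite !Rsqr_pow2.
assert (Hz2 : Cmod z ^ 2 <= 1) by (assert (H := Cmod_ge_0 z); nra).
rewrite Cmod2_alt in Hz2 |- *. rewrite Cmod2_alt.
destruct z as [u v]; simpl in *.
(* The product is [|1 - x z|^2 - |x - z|^2]. *)
assert (H : 0 <= (1 - x * x) * (1 - (u * (u * 1) + v * (v * 1))))
  by (apply Rmult_le_pos; nra).
lra.
Qed.

Lemma ex_derive_quadratic (F : C -> C) (z l : C) (K d : R) :
  0 < d ->
  (forall w, Cmod (w - z)%C < d ->
     Cmod (F w - F z - (w - z) * l)%C <= K * Cmod (w - z)%C ^ 2) ->
  @ex_derive C_AbsRing C_NormedModule F z.
Proof.
intros Hd H. exists l. split.
- apply (@is_linear_scal_l C_AbsRing C_NormedModule).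
- intros y Hy.
  (* The differential quantifies over all limits [y] of the neighbourhood filter of [z]; there is
     only one. *)
  assert (E : z = y).
  { apply (@is_filter_lim_locally_unique C_AbsRing
      (AbsRing_NormedModule C_AbsRing) z y Hy). }
  subst y. intros eps.
  assert (HK : 0 < Rabs K + 1) by (assert (h := Rabs_pos K); lra).
  assert (Hr : 0 < Rmin d (eps / (Rabs K + 1))).
  { apply Rmin_pos; [exact Hd |]. apply Rdiv_lt_0_compat; [apply cond_pos | exact HK]. }
  exists (mkposreal _ Hr). intros w Hw.
  change (Cmod (w - z)%C < Rmin d (eps / (Rabs K + 1))) in Hw.
  change (Cmod (F w - F z - (w - z) * l)%C <= eps * Cmod (w - z)%C).
  assert (Hw1 := Rlt_le_trans _ _ _ Hw (Rmin_l _ _)).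
  assert (Hw2 := Rlt_le_trans _ _ _ Hw (Rmin_r _ _)).
  eapply Rle_trans; [apply H, Hw1 |].
  assert (Hp := Cmod_ge_0 (w - z)%C). set (t := Cmod (w - z)%C) in *.
  apply Rmult_lt_compat_r with (r := Rabs K + 1) in Hw2; [| exact HK].
  unfold Rdiv in Hw2. rewrite Rmult_assoc, Rinv_l, Rmult_1_r in Hw2 by lra.
  simpl. rewrite Rmult_1_r, <- Rmult_assoc. apply Rmult_le_compat_r; [exact Hp |].
  assert (h := Rle_abs K). nra.
Qed.

(** The derivative is [- (1 - x^2) / (1 - x z)^2]. The exact remainder is quadratic in [w - z] with
    a factor [1 / (1 - x w)], which [blaschke_den_ge] bounds by [1 / (1 - x)]. *)
Lemma ex_derive_blaschke (x : R) (z : C) : 0 <= x < 1 -> Cmod z < 1 ->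
  @ex_derive C_AbsRing C_NormedModule (blaschke x) z.
Proof.
intros Hx Hz.
assert (Hdz := blaschke_den_neq_0 x z Hx Hz).
set (D := fun w => (1 - x * w)%C).
apply (ex_derive_quadratic _ z (- (1 - x ^ 2)%R / (D z * D z))%C
  (Cmod ((1 - x ^ 2)%R * x / (D z * D z))%C / (1 - x)) (1 - Cmod z)); [lra |].
intros w Hw.
assert (Hw1 : Cmod w < 1).
{ assert (H := Cmod_triangle (w - z) z).
  replace (w - z + z)%C with w in H by ring. lra. }
assert (Hdw := blaschke_den_neq_0 x w Hx Hw1).
assert (Hge := blaschke_den_ge x w Hx Hw1).
replace (blaschke x w - blaschke x z - (w - z) * (- (1 - x ^ 2)%R / (D z * D z)))%C
  with (- ((1 - x ^ 2)%R * x / (D z * D z)) * ((w - z) * (w - z)) / D w)%C.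
- rewrite Cmod_div, !Cmod_mult, Cmod_opp by exact Hdw.
  set (k := Cmod ((1 - x ^ 2)%R * x / _)%C). set (t := Cmod (w - z)%C).
  assert (Hk : 0 <= k) by apply Cmod_ge_0.
  replace (k / (1 - x) * t ^ 2) with (k * (t * t) * / (1 - x)) by (field; lra).
  apply Rmult_le_compat_l.
  + apply Rmult_le_pos; [exact Hk | apply Rle_0_sqr].
  + apply Rinv_le_contravar; [lra | exact Hge].
- unfold blaschke, D. rewrite RtoC_minus, RtoC_pow. field. split; assumption.
Qed.

Lemma partial_sum_blaschke (x : R) (z : C) (n : nat) :
  0 <= x < 1 -> Cmod z < 1 ->
  (partial_sum (blaschke_coeff x) (S n) z - blaschke x z)%C
  = ((1 - x ^ 2)%R * x ^ n / (1 - x * z) * Cpow z (S n))%C.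
Proof.
intros Hx Hz. assert (Hd := blaschke_den_neq_0 x z Hx Hz).
induction n as [| n IH].
- unfold blaschke. simpl partial_sum. simpl Cpow. rewrite RtoC_minus, RtoC_pow.
  field. exact Hd.
- assert (E : partial_sum (blaschke_coeff x) (S n) z = (blaschke x z
      + (1 - x ^ 2)%R * x ^ n / (1 - x * z) * Cpow z (S n))%C)
    by (rewrite <- IH; ring).
  rewrite partial_sum_S, E.
  change (blaschke_coeff x (S n)) with (RtoC (- (1 - x ^ 2) * x ^ n)).
  rewrite RtoC_mult, RtoC_opp, RtoC_pow, !Cpow_S. field. exact Hd.
Qed.

Lemma power_expansion_blaschke (x : R) : 0 <= x < 1 ->
  power_expansion (blaschke x) (blaschke_coeff x).
Proof.
intros Hx z Hz.
apply filterlim_locally. intros eps.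
(* Bounds the factor [(1 - x^2) x^n / |1 - x z|] in front of [|z|^(n+1)] in the remainder. *)
set (K := / (1 - x)).
assert (HK : 0 < K) by (apply Rinv_0_lt_compat; lra).
assert (He : 0 < eps / K) by (apply Rdiv_lt_0_compat; [apply cond_pos | lra]).
assert (Hz0 := Cmod_ge_0 z).
destruct (pow_lt_1_zero (Cmod z) ltac:(rewrite Rabs_pos_eq; lra) _ He) as [n0 Hn].
exists n0. intros n Hnn. rewrite sum_n_partial_sum.
apply C_NormedModule_mixin_compat1.
change (Cmod (partial_sum (blaschke_coeff x) (S n) z - blaschke x z)%C < eps).
rewrite partial_sum_blaschke, !Cmod_mult, Cmod_div, Cmod_mult, !Cmod_pow, !Cmod_R
  by (assumption || now apply blaschke_den_neq_0).
assert (Hd := blaschke_den_ge x z Hx Hz).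
specialize (Hn (S n) ltac:(lia)).
rewrite Rabs_pos_eq in Hn by now apply pow_le.
rewrite !Rabs_pos_eq by nra.
apply Rle_lt_trans with (K * Cmod z ^ S n).
- apply Rmult_le_compat_r; [now apply pow_le |].
  rewrite <- (Rmult_1_l K). unfold Rdiv. apply Rmult_le_compat.
  + apply Rmult_le_pos; [nra | apply pow_le; lra].
  + apply Rlt_le, Rinv_0_lt_compat. lra.
  + assert (H1 : 0 <= x ^ n <= 1)
      by (split; [apply pow_le; lra | rewrite <- (pow1 n); apply pow_incr; lra]).
    assert (H2 : 0 <= x ^ 2 <= 1) by nra. nra.
  + apply Rinv_le_contravar; lra.
- apply (Rmult_lt_compat_l K) in Hn; [| exact HK].
  replace (K * (eps / K)) with (pos eps) in Hn by (field; lra). exact Hn.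
Qed.

Lemma classB_blaschke (x : R) : 0 <= x < 1 -> classB (blaschke x).
Proof.
intros Hx z Hz. split; [now apply ex_derive_blaschke | now apply blaschke_le_1].
Qed.

Lemma majorant_tail_blaschke (x r : R) : 0 <= x < 1 -> 0 <= r < 1 ->
  is_majorant_tail (blaschke_coeff x) r (r * (1 - x ^ 2) / (1 - x * r)).
Proof.
intros Hx Hr. unfold is_majorant_tail.
assert (Hxr : 0 <= x * r < 1) by nra.
apply is_series_ext with (fun k => scal (r * (1 - x ^ 2)) ((x * r) ^ k)).
- intros k. simpl blaschke_coeff.
  rewrite Cmod_R, Rabs_mult, Rabs_Ropp, !Rabs_pos_eq
    by (nra || (apply pow_le; lra)).
  rewrite Rpow_mult_distr. unfold scal; simpl; unfold mult; simpl. ring.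
- apply (@is_series_scal_l R_AbsRing R_NormedModule (r * (1 - x ^ 2))
    (fun k => (x * r) ^ k) (/ (1 - x * r))).
  apply is_series_geom.
  rewrite Rabs_pos_eq; lra.
Qed.

(** * Sharpness of the radius *)

Lemma classB_mult_id (g : C -> C) : classB g -> classB (fun z => z * g z)%C.
Proof.
intros Hg z Hz. destruct (Hg z Hz) as [Hd Hb]. split.
- apply ex_derive_filterdiff in Hd. destruct Hd as [l Hl].
  apply (@ex_derive_filterdiff C_AbsRing C_NormedModule). eexists.
  apply (@filterdiff_scal_fct C_AbsRing (AbsRing_NormedModule C_AbsRing)
    C_NormedModule z (fun z => z) g (fun y => y) l Cmult_comm).
  + apply filterdiff_id.
  + exact Hl.
- rewrite Cmod_mult. assert (H := Cmod_ge_0 z). assert (H' := Cmod_ge_0 (g z)). nra.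
Qed.

(** The Blaschke tail [r (1 - x^2) / (1 - x r)] exceeds [T = 1 - x^p] exactly when
    [r > T / (1 - x^2 + x T)], the radius in this range. *)
Lemma bohr_sharp_large (p x r : R) : 0 < p -> Cp p <= x < 1 ->
  bohr_radius p x < r < 1 ->
  exists s, is_majorant_tail (blaschke_coeff x) r s /\ rpow x p + s > 1.
Proof.
intros Hp Hx Hr. destruct (Cp_correct p Hp) as [HC _].
assert (HT := rpow_bounds x p Hp ltac:(lra)).
unfold bohr_radius in Hr.
destruct (Rlt_dec x (Cp p)); [lra |]. destruct (Rlt_dec x 1); [| lra].
remember (1 - rpow x p) as T eqn:ET.
assert (Hx2 : 0 < 1 - x ^ 2).
{ assert (0 < (1 - x) * (1 + x)) by (apply Rmult_lt_0_compat; lra). lra. }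
assert (HD : 0 < 1 - x ^ 2 + x * T).
{ assert (0 < x * T) by (apply Rmult_lt_0_compat; lra). lra. }
assert (Hq : 0 < T / (1 - x ^ 2 + x * T)) by (apply Rdiv_lt_0_compat; lra).
assert (H : T < r * (1 - x ^ 2 + x * T)).
{ destruct Hr as [Hr _].
  apply (Rmult_lt_compat_r (1 - x ^ 2 + x * T)) in Hr; [| exact HD].
  unfold Rdiv in Hr. rewrite Rmult_assoc, Rinv_l, Rmult_1_r in Hr; lra. }
exists (r * (1 - x ^ 2) / (1 - x * r)). split.
- apply majorant_tail_blaschke; lra.
- assert (Hxr : x * r < 1) by nra.
  enough (T < r * (1 - x ^ 2) / (1 - x * r)) by lra.
  apply Rmult_lt_reg_r with (1 - x * r); [lra |].
  unfold Rdiv. rewrite Rmult_assoc, Rinv_l by lra. lra.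
Qed.

Lemma bohr_radius_0 (p : R) : 0 < p -> 0 < bohr_radius p 0 /\ bohr_radius p 0 ^ 2 = / 2.
Proof.
intros Hp. destruct (Cp_correct p Hp) as [HC _].
unfold bohr_radius. destruct (Rlt_dec 0 (Cp p)); [| lra].
unfold rpow. destruct (Req_EM_T 0 0); [| lra].
replace (1 - 0 ^ 2 + (1 - 0) ^ 2) with 2 by ring.
assert (H : 0 < sqrt 2) by (apply sqrt_lt_R0; lra). split.
- apply Rdiv_lt_0_compat; lra.
- unfold Rdiv. rewrite Rpow_mult_distr, pow_inv, pow2_sqrt by lra. field.
Qed.

Lemma bohr_sharp_0 (b r : R) : 0 < b < r -> r < 1 -> b ^ 2 = / 2 ->
  exists s, is_majorant_tail (@PS_incr_1 C_AbsRing C_NormedModule (blaschke_coeff b)) r s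
    /\ s > 1.
Proof.
intros Hb Hr Hb2.
assert (Hbr : b * r < 1) by nra.
exists (r * (b + r * (1 - b ^ 2) / (1 - b * r))). split.
- unfold is_majorant_tail.
  apply (@is_series_ext R_AbsRing R_NormedModule
    (fun k => scal r (Cmod (blaschke_coeff b k) * r ^ k))).
  + intros k. simpl PS_incr_1. unfold scal; simpl; unfold mult; simpl. ring.
  + apply (@is_series_scal_l R_AbsRing R_NormedModule r).
    (* Removing the leading term [b] leaves the tail of the Blaschke factor itself. *)
    apply (@is_series_decr_1 R_AbsRing R_NormedModule).
    replace (plus _ _) with (r * (1 - b ^ 2) / (1 - b * r)).
    * apply majorant_tail_blaschke; lra.
    * simpl. rewrite Cmod_R, Rabs_pos_eq by lra.
      unfold plus, opp; simpl. ring.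
- apply Rlt_gt, Rmult_lt_reg_r with (1 - b * r); [lra |].
  (* At [b^2 = 1/2] the quadratic term drops out, and the claim becomes [2 b r > 1 = 2 b^2], that is
     [r > b]. *)
  replace (r * (b + r * (1 - b ^ 2) / (1 - b * r)) * (1 - b * r))
    with (r * b + r ^ 2 * (1 - 2 * b ^ 2)) by (field; lra).
  rewrite Hb2. nra.
Qed.

Theorem theorem1 :
  forall p : R, 0 < p ->
    (forall (f : C -> C) (a : nat -> C),
        classB f -> power_expansion f a ->
        forall r : R, 0 <= r <= bohr_radius p (Cmod (a 0%nat)) ->
          exists s : R,
            is_majorant_tail a r s /\ rpow (Cmod (a 0%nat)) p + s <= 1)
    /\
    (forall x : R, Cp p <= x < 1 \/ x = 0 ->
      forall r : R, bohr_radius p x < r < 1 ->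
        exists (f : C -> C) (a : nat -> C),
          classB f /\ power_expansion f a /\ Cmod (a 0%nat) = x /\
          exists s : R, is_majorant_tail a r s /\ rpow x p + s > 1).
Proof.
intros p Hp. split.
- intros f a Hf Ha r Hr. exact (bohr_inequality p f a r Hp Hf Ha Hr).
- intros x [Hx | ->] r Hr.
  + destruct (Cp_correct p Hp) as [HC _].
    exists (blaschke x), (blaschke_coeff x).
    split; [apply classB_blaschke; lra |].
    split; [apply power_expansion_blaschke; lra |].
    split; [simpl; rewrite Cmod_R, Rabs_pos_eq; lra |].
    now apply bohr_sharp_large.
  + destruct (bohr_radius_0 p Hp) as [Hb Hb2].
    set (b := bohr_radius p 0) in *.
    exists (fun z => z * blaschke b z)%C,
      (@PS_incr_1 C_AbsRing C_NormedModule (blaschke_coeff b)).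
    split; [apply classB_mult_id, classB_blaschke; lra |].
    split; [| split; [exact Cmod_0 |]].
    * intros z Hz. apply (@is_pseries_incr_1 C_AbsRing C_NormedModule).
      apply power_expansion_blaschke; [lra | exact Hz].
    * destruct (bohr_sharp_0 b r ltac:(lra) ltac:(lra) Hb2) as [s [Hs Hs1]].
      exists s. split; [exact Hs |].
      (* Here [rpow 0 p = 0], so the tail alone has to exceed 1. *)
      unfold rpow. destruct (Req_EM_T 0 0); lra.
Qed.
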